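(* Let $f:\mathbb{R}^n\to\mathbb{R}^n$ be locally Lipschitz and consider the dynamical system $\dot x=f(x)$. Let $h:\mathbb{R}^n\to\mathbb{R}$ be continuously differentiable and let $\mathcal{C}\subset\mathbb{R}^n$ be a set such that $$\mathcal{C}=\{x\in\mathbb{R}^n: h(x)\ge 0\},\quad \partial\mathcal{C}=\{x\in\mathbb{R}^n: h(x)=0\},\quad \mathrm{Int}(\mathcal{C})=\{x\in\mathbb{R}^n: h(x)>0\}.$$ If $h$ is a zeroing barrier function for $\mathcal{C}$ defined on a set $\mathcal{D}$ with $\mathcal{C}\subseteq\mathcal{D}\subset\mathbb{R}^n$, then $\mathcal{C}$ is forward invariant with respect to $\dot x=f(x)$.
   Context: $\mathrm{Int}(\mathcal{C})$ and $\partial\mathcal{C}$ denote the interior and boundary of $\mathcal{C}$. A continuous function $\alpha:(-b,a)\to(-\infty,\infty)$, for some $a,b>0$ (possibly infinite), is of extended class $\mathcal{K}$ if it is strictly increasing and $\alpha(0)=0$. Whenever $\alpha(s)$ is written, $s$ is understood to lie in the domain of $\alpha$. $L_fh(x)=\frac{\partial h}{\partial x}(x)f(x)$ is the Lie derivative. Zeroing barrier function (ZBF): the continuously differentiable function $h$ is a ZBF for $\mathcal{C}$ defined on $\mathcal{D}$ (where $\mathcal{C}\subseteq\mathcal{D}\subset\mathbb{R}^n$) if there exists an extended class $\mathcal{K}$ function $\alpha$ such that $L_fh(x)\ge-\alpha(h(x))$ for all $x\in\mathcal{D}$. For $x_0\in\mathbb{R}^n$, let $I(x_0)=[t_0,\tau_{\max})$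 be the maximal interval of existence of the unique solution $x(t)$ of $\dot x=f(x)$ with $x(t_0)=x_0$. A set $\mathcal{S}$ is (forward) invariant if for every $x_0\in\mathcal{S}$, $x(t)\in\mathcal{S}$ for all $t\in I(x_0)$.
   Formalization: Added hypothesis: at each boundary point of C, either D is a neighbourhood of the point or the gradient of h is nonzero there; without it the claim fails, e.g. f=-1, h=x^3, C=D=[0,∞), α(s)=3 sgn(s)|s|^{2/3}. *)

(* Defs.v *)
From HB Require Import structures.
From mathcomp Require Import all_boot all_order all_algebra.
From mathcomp Require Import all_classical all_reals all_analysis.

Set Implicit Arguments.
Unset Strict Implicit.
Unset Printing Implicit Defensive.

Import Order.TTheory GRing.Theory Num.Theory.
Import numFieldNormedType.Exports.

Local Open Scope classical_set_scope.
Local Open Scope ring_scope.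

(* R^n is 'rV[R]_n.  Its library norm is the sup norm, which has the same
   topology, differentiable maps and locally Lipschitz maps as the Euclidean
   norm. *)

Definition boundary {T : topologicalType} (A : set T) : set T :=
  closure A `\` interior A.

Definition locally_lipschitz {R : realType} {n : nat}
    (f : 'rV[R]_n -> 'rV[R]_n) : Prop :=
  forall x : 'rV[R]_n,
    exists2 U : set 'rV[R]_n, nbhs x U & [lipschitz f y | y in U].

(* In finite dimension, continuity of x |-> 'd h x v for each v amounts to
   continuity of all the partial derivatives. *)
Definition continuously_differentiable {R : realType} {n : nat}
    (h : 'rV[R]_n -> R) : Prop :=
  (forall x, differentiable h x) /\
  (forall v, continuous (fun x => 'd h x v)).

Definition lie_derivative {R : realType} {n : nat}
    (f : 'rV[R]_n -> 'rV[R]_n) (h : 'rV[R]_n -> R) (x : 'rV[R]_n) : R :=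
  'd h x (f x).

(* The interval (-b, a), where a and b may be +oo. *)
Definition classK_domain {R : realType} (a b : \bar R) : set R :=
  [set s : R | (- b < s%:E)%E /\ (s%:E < a)%E].

(* alpha is a total function of which only the restriction to (-b, a)
   matters. *)
Definition extended_classK {R : realType} (a b : \bar R) (alpha : R -> R) :
    Prop :=
  [/\ (0 < a)%E, (0 < b)%E,
      {within classK_domain a b, continuous alpha},
      {in classK_domain a b &, forall r s : R, r < s -> alpha r < alpha s}
    & alpha 0 = 0].

Definition zeroing_barrier_function {R : realType} {n : nat}
    (f : 'rV[R]_n -> 'rV[R]_n) (h : 'rV[R]_n -> R) (C D : set 'rV[R]_n) :
    Prop :=
  [/\ continuously_differentiable h, C `<=` D &
    exists (a b : \bar R) (alpha : R -> R),
      extended_classK a b alpha /\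
      forall x, D x ->
        classK_domain a b (h x) /\ lie_derivative f h x >= - alpha (h x)].

(* At each boundary point of C, either D is a neighbourhood of the point (as
   when D is open) or the gradient of h does not vanish there (as in Nagumo's
   theorem).  Some condition of this kind is needed for a barrier function to
   give invariance: for n = 1, f = -1, h x = x ^ 3 and C = D = [0, +oo), the
   inequality L_f h >= - alpha (h) holds on D with
   alpha s = 3 sgn(s) |s| ^ (2/3), but every trajectory leaves C. *)
Definition barrier_domain {R : realType} {n : nat}
    (h : 'rV[R]_n -> R) (C D : set 'rV[R]_n) : Prop :=
  forall x, boundary C x -> nbhs x D \/ exists v, 'd h x v != 0.

(* x solves x' = f x on [t0, tau) with x t0 = x0, where tau may be +oo.  The
   one-sided derivative at t0 is not mentioned: it exists and equals f x0
   because x is continuous at t0 and f is continuous. *)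
Definition is_solution {R : realType} {n : nat} (f : 'rV[R]_n -> 'rV[R]_n)
    (t0 : R) (x0 : 'rV[R]_n) (tau : \bar R) (x : R -> 'rV[R]_n) : Prop :=
  [/\ (t0%:E < tau)%E, x t0 = x0,
      {within [set t : R | t0 <= t /\ (t%:E < tau)%E], continuous x}
    & forall t : R, t0 < t -> (t%:E < tau)%E -> is_derive t 1 x (f (x t))].

Definition is_maximal_solution {R : realType} {n : nat}
    (f : 'rV[R]_n -> 'rV[R]_n) (t0 : R) (x0 : 'rV[R]_n) (tau_max : \bar R)
    (x : R -> 'rV[R]_n) : Prop :=
  is_solution f t0 x0 tau_max x /\
  forall (tau : \bar R) (y : R -> 'rV[R]_n),
    is_solution f t0 x0 tau y -> (tau <= tau_max)%E.

Definition forward_invariant {R : realType} {n : nat}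
    (f : 'rV[R]_n -> 'rV[R]_n) (S : set 'rV[R]_n) : Prop :=
  forall (t0 : R) (x0 : 'rV[R]_n), S x0 ->
  forall (tau_max : \bar R) (x : R -> 'rV[R]_n),
    is_maximal_solution f t0 x0 tau_max x ->
    forall t : R, t0 <= t -> (t%:E < tau_max)%E -> S (x t).

(* Main.v *)
Require Import Defs.
From HB Require Import structures.
From mathcomp Require Import all_boot all_order all_algebra.
From mathcomp Require Import all_classical all_reals all_analysis.
From mathcomp Require Import ring lra.
Import Order.TTheory GRing.Theory Num.Theory.
Import numFieldNormedType.Exports.
Local Open Scope classical_set_scope.
Local Open Scope ring_scope.

(** Suppose [h (x t) < 0] on an interval [(c, t]] with [h (x c) = 0].  If [D] is
    a neighbourhood of [x c], the barrier inequality makes [h (x s)] nondecreasing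
    while it is negative, since then [- alpha (h (x s)) > 0].  Otherwise some [v]
    satisfies ['d h (x c) v > 0], and only the inequality [L_f h >= 0] on
    [h = 0] is used: the curve [z s = x s + eta * (1 + M * (s - c)) *: v] starts
    in [h > 0], and wherever [h (z s) = 0], the Lipschitz error made in replacing
    [f (x s)] by [f (z s)] is beaten by the drift [eta * M *: v], so [h \o z] is
    increasing there and [z] never leaves [h >= 0].  Let [eta] tend to [0]. *)

(** * Zeros, growth and derivatives of real functions along curves *)

(** Take [c] as the maximum of the compact set where [0 <= g]. Beyond [c] the function is negative,
    so the zero that the intermediate value theorem gives on [[c, b]] can only be [c]. *)
Lemma last_zero (R : realType) (g : R -> R) (a b : R) :
  a <= b -> {within `[a, b], continuous g} -> 0 <= g a -> g b < 0 ->
  exists2 c, a <= c < b & g c = 0 /\ forall s, c < s <= b -> g s < 0.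
Proof.
move=> ab cg ga gb.
pose A := `[a, b] `&` g @^-1` [set y | 0 <= y].
have clA : closed A.
  rewrite closed_setSI; last exact: interval_closed.
  by move/continuous_closedP: cg; apply; exact: closed_ge.
have cA : compact A.
  by apply: (subclosed_compact clA (@segment_compact _ a b)) => ? [].
have A0 : A !=set0 by exists a; split; rewrite //= in_itv/= lexx.
have [|c] := @compact_EVT_max R R id A A0 cA.
  by apply: continuous_subspaceT => s; exact: cvg_id.
rewrite inE => -[/=]; rewrite in_itv/= => /andP[ac cb] gc cmax.
have neg s : c < s <= b -> g s < 0.
  move=> /andP[cs sb]; rewrite ltNge; apply/negP => gs.
  suff: s <= c by rewrite leNgt cs.
  by apply: cmax; rewrite inE; split; rewrite //= in_itv/= sb (le_trans ac (ltW cs)).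
have {}cb : c < b.
  by rewrite lt_neqAle cb andbT; apply: contraTneq gb => <-; rewrite -leNgt.
exists c; first by rewrite ac.
split=> //.
have cgc : {within `[c, b], continuous g}.
  by apply: continuous_subspaceW cg => s /=; rewrite !in_itv/= => /andP[/(le_trans ac)->].
have [|d] := @IVT R g c b 0 (ltW cb) cgc.
  by rewrite ge_min le_max gc (ltW gb) orbT.
rewrite in_itv/= => /andP[]; rewrite le_eqVlt => /predU1P[-> //|cd db gd].
by have := neg d; rewrite cd db gd ltxx => /(_ isT).
Qed.

Lemma is_derive_gt0_right (R : realType) (g : R -> R) (t k : R) :
  is_derive t 1 g k -> 0 < k -> \forall s \near t^'+, g t < g s.
Proof.
move=> [dg dgE] k0.
have gk : (fun e => e^-1 *: (g (e *: 1 + t) - g t)) @ 0^' --> k.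
  by rewrite -dgE; exact: dg.
have : \forall e \near 0^', 0 < e^-1 *: (g (e *: 1 + t) - g t) by exact: (cvgr_gt _ gk).
rewrite !near_withinE => /nbhs_ballP[e /= e0 he].
apply/nbhs_ballP; exists e => //= s se ts.
have /he : ball 0 e (s - t).
  by move: se; rewrite /ball/= sub0r normrN distrC.
rewrite subr_eq0 gt_eqF// => /(_ isT).
rewrite pmulr_rgt0 ?invr_gt0 ?subr_gt0//.
by rewrite /GRing.scale/= mulr1 subrK.
Qed.

Lemma is_derive_diff_comp (R : realType) (V : normedModType R) (x : R -> V)
    (h : V -> R) (t : R) (w : V) :
  is_derive t 1 x w -> differentiable h (x t) ->
  is_derive t 1 (h \o x) ('d h (x t) w).
Proof.
move=> [/derivable1_diffP dx <-] dh.
have dhx : differentiable (h \o x) t by exact: differentiable_comp.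
split; first exact/derivable1_diffP.
by rewrite !deriveE// diff_comp.
Qed.

(** * Local bounds on the differential *)

Lemma linear_row_norm_le (R : realType) (n : nat) (l : {linear 'rV[R]_n -> R})
    (w : 'rV[R]_n) : `|l w| <= (\sum_(i < n) `|l 'e_i|) * `|w|.
Proof.
have /(congr1 l) -> := row_sum_delta w.
rewrite linear_sum mulr_suml.
apply: le_trans (ler_norm_sum _ _ _) _.
apply: ler_sum => i _.
rewrite linearZ normrM mulrC ler_wpM2l//.
have -> : `|w| = mx_norm w by [].
by rewrite mx_normrE; apply: (le_bigmax _ _ (ord0, i)).
Qed.

(** Each of the finitely many partial derivatives is continuous, hence stays near [p] within 1 of
    its size at [p]; expanding [w] in the standard basis gives one [K] for all [z] near [p]. *)
Lemma diff_bounded_near (R : realType) (n : nat) (h : 'rV[R]_n -> R) (p : 'rV[R]_n) :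
  continuously_differentiable h ->
  exists2 K, 0 <= K & \forall z \near p, forall w, `|'d h z w| <= K * `|w|.
Proof.
move=> [dh cdh].
exists (\sum_(i < n) (`|'d h p 'e_i| + 1)); first by apply: sumr_ge0 => i _; rewrite addr_ge0.
have N : \forall z \near p, forall i : 'I_n, `|'d h z 'e_i| < `|'d h p 'e_i| + 1.
  apply: (@filter_forall _ 'I_n (fun i z => `|'d h z 'e_i| < `|'d h p 'e_i| + 1)
    (nbhs p) (nbhs_filter p)) => i.
  by apply: (cvgr_lt _ (cvg_norm (cdh 'e_i p))); rewrite ltrDl.
apply: filterS N => z N w.
apply: le_trans (linear_row_norm_le _ _ ('d h z) w) _.
by rewrite ler_wpM2r// ler_sum// => i _; exact/ltW.
Qed.

(** * Affine perturbations and restrictions of curves *)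

Lemma is_derive_affine (R : realType) (V : normedModType R) (v : V) (a b t : R) :
  is_derive t 1 (fun u => (a * u + b) *: v) (a *: v).
Proof.
have -> : (fun u => (a * u + b) *: v) = ( *:%R ^~ (a *: v)) + cst (b *: v).
  by apply/funext => u; rewrite /= fctE scalerDl scalerA mulrC.
have D : is_derive t 1 ( *:%R ^~ (a *: v)) (a *: v).
  have [dS dE] := is_diff_scalel t (a *: v).
  by split; [exact: diff_derivable | rewrite deriveE// dE scale1r].
by apply: is_derive_eq; rewrite addr0.
Qed.

Lemma continuous_affine (R : realType) (V : normedModType R) (v : V) (a b : R) :
  continuous (fun u : R => (a * u + b) *: v).
Proof.
move=> u; apply/differentiable_continuous/derivable1_diffP.
by have [] := is_derive_affine _ _ v a b u.
Qed.

Lemma within_continuous_comp (S T U : topologicalType) (A : set S) (x : S -> T)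
    (h : T -> U) :
  {within A, continuous x} -> continuous h -> {within A, continuous (h \o x)}.
Proof.
move=> /subspace_continuousP cx ch; apply/subspace_continuousP => s As.
exact: (cvg_comp _ _ (cx s As) (ch (x s))).
Qed.

Lemma near_right_segment (R : realType) (T : topologicalType) (x : R -> T) (c b : R)
    (P : set T) :
  c < b -> {within `[c, b], continuous x} -> nbhs (x c) P ->
  \forall s \near c^'+, forall u, c <= u <= s -> P (x u).
Proof.
move=> cb /subspace_continuousP/(_ c) + xP.
rewrite /= in_itv/= lexx ltW// => /(_ isT _ xP) xc.
have /nbhs_ballP[d /= d0 hd] : nbhs c [set u | c <= u <= b -> P (x u)].
  by apply: (@filterS _ (nbhs c) _ _ _ _ xc) => u; rewrite /= in_itv.
near=> s => u /andP[cu us].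
have sb : s <= b by near: s; exact: nbhs_right_le.
apply: hd; last by rewrite cu (le_trans us).
rewrite /ball/= distrC ger0_norm ?subr_ge0// ltrBlDl (le_lt_trans us)//.
by near: s; apply: nbhs_right_lt; rewrite ltrDl.
Unshelve. all: by end_near. Qed.

(** * Boundary points where the gradient does not vanish *)

(** The limit in [eta] is taken by contradiction: [s] is fixed first, close to [c] in terms of [r]
    and [M] only. If [h (x s) < 0], a small [eta] keeps [h (z s) < 0], so [h \o z] has a last zero,
    where its derivative is nevertheless positive. *)
Lemma nagumo_regular_point (R : realType) (n : nat) (f : 'rV[R]_n -> 'rV[R]_n)
    (h : 'rV[R]_n -> R) (v : 'rV[R]_n) (x : R -> 'rV[R]_n) (c b : R) :
  locally_lipschitz f -> continuously_differentiable h ->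
  (forall z, h z = 0 -> 0 <= 'd h z (f z)) ->
  c < b -> {within `[c, b], continuous x} ->
  (forall t, c < t < b -> is_derive t 1 x (f (x t))) ->
  h (x c) = 0 -> 0 < 'd h (x c) v ->
  \forall s \near c^'+, 0 <= h (x s).
Proof.
move=> hf hh hz cb cx dx hp dv.
have [dh cdh] := hh.
set p := x c in hp dv.
pose k : R := 'd h p v / 2.
have k0 : 0 < k by rewrite divr_gt0.
have N1 : \forall z \near p, k < 'd h z v.
  by apply: (cvgr_gt _ (cdh v p)); rewrite /k; lra.
have [K K0 N2] := diff_bounded_near _ _ _ p hh.
have [U pU [M0 [_ lipU]]] := hf p.
(* The Lipschitz bound holds for every constant strictly above [M0]; the absolute value makes [L]
   nonnegative. *)
pose L : R := `|M0| + 1.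
have LU y z : U y -> U z -> `|f y - f z| <= L * `|y - z|.
  move=> Uy Uz; apply: (lipU L _ (y, z)) => //.
  by rewrite /L (le_lt_trans (ler_norm _))// ltrDl.
have L0 : 0 <= L by rewrite addr_ge0.
have /nbhs_ballP[r /= r0 hr] : \forall z \near p,
    [/\ k < 'd h z v, forall w, `|'d h z w| <= K * `|w| & U z].
  by near do split.
(* Per unit of [eta], [K * L * (2 * |v|)] bounds the effect on [h] of the Lipschitz error; the 1
   makes [N] strictly larger. With [M = N / k] the drift contributes more than [N]. *)
pose N : R := K * L * (2 * `|v|) + 1.
have N0 : 0 < N by rewrite ltr_wpDl// !mulr_ge0.
pose M : R := N / k.
have Mgt0 : 0 < M by rewrite divr_gt0.
have N3 : \forall s \near c^'+, forall u, c <= u <= s -> ball p (r / 2) (x u).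
  by apply: (near_right_segment _ _ _ _ _ _ cb cx); apply: nbhsx_ballx; rewrite divr_gt0.
near=> s.
have cs : c < s by [].
have sb : s < b by near: s; exact: nbhs_right_lt.
(* This keeps the factor [1 + M * (u - c)] at most 2, so the displacement bound, and with it [N],
   does not depend on [M]. *)
have sM : s < c + M^-1 by near: s; apply: nbhs_right_lt; rewrite ltrDl invr_gt0.
have pxu : forall u, c <= u <= s -> ball p (r / 2) (x u) by near: s.
have Mu u : c <= u <= s -> 0 <= M * (u - c) <= 1.
  move=> /andP[cu us]; rewrite mulr_ge0 ?subr_ge0 ?(ltW Mgt0)//=.
  by rewrite -ler_pdivlMl// mulr1 lerBlDl (le_trans us (ltW sM)).
rewrite leNgt; apply/negP => hxs.
pose m := 1 + M * (s - c).
have F2 : \forall e \near 0^'+, h (x s + (m * e + 0) *: v) < 0.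
  have C : h (x s + (m * e + 0) *: v) @[e --> (0 : R)] --> h (x s + (m * 0 + 0) *: v).
    apply: continuous_comp; last exact: differentiable_continuous.
    by apply: cvgD; [exact: cvg_cst | exact: continuous_affine].
  apply: (cvgr_lt _ (cvg_at_right_filter C)).
  by rewrite mulr0 addr0 scale0r addr0.
(* At [e = 0] the function is [h p = 0] and its derivative is ['d h p v > 0]. *)
have F3 : \forall e \near 0^'+, 0 < h (p + (1 * e + 0) *: v).
  have D : is_derive (0 : R) 1 (fun e : R => p + (1 * e + 0) *: v) (0 + 1 *: v).
    exact: (is_deriveD (is_derive_cst p (0 : R) 1) (is_derive_affine _ _ v 1 0 0)).
  have E0 : p + (1 * 0 + 0) *: v = p by rewrite mulr0 addr0 scale0r addr0.
  have := is_derive_diff_comp _ _ _ h _ _ D (dh _).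
  move/is_derive_gt0_right; rewrite /= E0 hp add0r scale1r; exact.
have [eta [eta0 e1 e2 e3]] : exists eta : R, [/\ 0 < eta, eta * (2 * `|v|) < r / 2,
    h (x s + (eta * m) *: v) < 0 & 0 < h (p + eta *: v)].
  apply: (@filter_ex _ (0^'+)); near=> e; split.
  - by [].
  (* Adding 1 makes the divisor positive without a separate argument for [v]. *)
  - have v0 : 0 < 2 * `|v| + 1 by rewrite ltr_wpDl// mulr_ge0.
    have : e < r / 2 / (2 * `|v| + 1).
      by near: e; apply: nbhs_right_lt; rewrite !divr_gt0.
    rewrite ltr_pdivlMr//; apply: le_lt_trans.
    by rewrite ler_pM2l// lerDl.
  - by rewrite mulrC -(addr0 (m * e)); near: e.
  - by rewrite -(mul1r e) -(addr0 (1 * e)); near: e.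
pose w u := (eta * (1 + M * (u - c))) *: v.
have wE : w = fun u => ((eta * M) * u + eta * (1 - M * c)) *: v.
  by apply/funext => u; rewrite /w; congr (_ *: _); ring.
pose z u := x u + w u.
have xz u : c <= u <= s -> `|z u - x u| <= eta * (2 * `|v|).
  move=> /Mu/andP[m0 m1]; rewrite /z /w addrAC subrr add0r normrZ mulrA ler_wpM2r//.
  rewrite normrM gtr0_norm// ler_pM2l// ger0_norm ?addr_ge0//.
  by rewrite -[2]/(1 + 1) lerD2l.
have pz u : c <= u <= s -> ball p r (z u).
  move=> cus; have := pxu _ cus; rewrite -!ball_normE/= => px.
  rewrite -(subrKA (x u)) (le_lt_trans (ler_normD _ _))// (splitr r) ltr_leD//.
  by rewrite distrC (le_trans (xz _ cus))// ltW.
have cz : {within `[c, s], continuous (h \o z)}.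
  apply: within_continuous_comp; last by move=> ?; exact: differentiable_continuous.
  have cw : continuous w by rewrite wE; exact: continuous_affine.
  have cxs : {within `[c, s], continuous x}.
    by apply: continuous_subspaceW cx; apply: subset_itvl; rewrite bnd_simp ltW.
  by move=> u; apply: cvgD; [exact: cxs | exact: (continuous_subspaceT cw)].
have [||e /andP[ce es] [he hneg]] := last_zero _ _ c s (ltW cs) cz.
- by rewrite /= /z /w subrr mulr0 addr0 mulr1 ltW.
- exact: e2.
(* The zero is not at [c], where [h \o z] is positive; hence [e] is interior and [x] is derivable
   there. *)
move: ce; rewrite le_eqVlt => /predU1P[ce|ce].
  by move: he; rewrite /= /z /w -ce subrr mulr0 addr0 mulr1 -/p => he; rewrite he ltxx in e3.
have ces : c <= e <= s by rewrite !ltW.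
have dz : is_derive e 1 z (f (x e) + (eta * M) *: v).
  have Dx := dx e; rewrite ce (lt_trans es sb) in Dx.
  have Dw : is_derive e 1 w ((eta * M) *: v) by rewrite wE; exact: is_derive_affine.
  exact: (is_deriveD (Dx isT) Dw).
have [zv zK Uz] := hr _ (pz _ ces).
have [_ _ Ux] : [/\ k < 'd h (x e) v, forall w, `|'d h (x e) w| <= K * `|w| & U (x e)].
  apply: hr; apply: (le_ball _ (pxu _ ces)).
  by rewrite ler_pdivrMr// ler_peMr ?ltW// ltr1n.
have G : is_derive e 1 (h \o z) ('d h (z e) (f (x e) + (eta * M) *: v)).
  exact: is_derive_diff_comp.
have Gpos : 0 < 'd h (z e) (f (x e) + (eta * M) *: v).
  (* Of the three resulting terms, the one in [f (z e)] is nonnegative because [h (z e) = 0], and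
     the drift outweighs the Lipschitz error [y]. *)
  have -> : f (x e) = f (z e) - (f (z e) - f (x e)) by rewrite subKr.
  set y := f (z e) - f (x e).
  have -> : 'd h (z e) (f (z e) - y + (eta * M) *: v) =
      'd h (z e) (f (z e)) - 'd h (z e) y + eta * M * 'd h (z e) v :> R.
    by rewrite linearD linearB linearZ.
  have B0 := hz _ he.
  have B1 : 'd h (z e) y <= eta * (K * L * (2 * `|v|)).
    rewrite (le_trans (ler_norm _))// (le_trans (zK _))// mulrCA -!mulrA.
    rewrite ler_wpM2l//; apply: le_trans (LU _ _ Uz Ux) _.
    by rewrite ler_wpM2l// xz.
  have B2 : eta * N < eta * M * 'd h (z e) v.
    by rewrite -(mulrA eta) ltr_pM2l// /M mulrAC ltr_pdivlMr// ltr_pM2l//.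
  rewrite -addrA; apply: (ltr_wpDl B0).
  rewrite addrC subr_gt0; apply: (le_lt_trans B1); apply: lt_trans B2.
  by rewrite ltr_pM2l// ltrDl.
have Ginc := is_derive_gt0_right _ _ _ _ G Gpos.
have [u [eu us heu]] : exists u, [/\ e < u, u <= s & (h \o z) e < (h \o z) u].
  apply: (@filter_ex _ (e^'+)); near=> u; split.
  - by [].
  - by near: u; exact: nbhs_right_le.
  - by near: u.
by have := lt_trans heu (hneg _ (introT andP (conj eu us))); rewrite he ltxx.
Unshelve. all: by end_near. Qed.

(** * Forward invariance *)

Theorem proposition1 (R : realType) (n : nat)
    (f : 'rV[R]_n -> 'rV[R]_n) (h : 'rV[R]_n -> R) (C D : set 'rV[R]_n)
    (hf : locally_lipschitz f)
    (hh : continuously_differentiable h)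
    (hC : C = [set x | 0 <= h x])
    (hbC : boundary C = [set x | h x = 0])
    (hiC : interior C = [set x | 0 < h x])
    (hCD : C `<=` D)
    (hD : barrier_domain h C D)
    (hzbf : zeroing_barrier_function f h C D) :
  forward_invariant f C.
Proof.
move=> t0 x0 Cx0 tau x [[_ xt0 cx dx] _] t t0t ttau.
have [_ _ [a [b [alpha [[a0 b0 _ alphaI alpha0] hL]]]]] := hzbf.
have dom0 : classK_domain a b 0 by split=> //; rewrite oppe_lt0.
have [dh _] := hh.
have ch : continuous h by move=> ?; exact: differentiable_continuous.
(* Zeros of [h] lie in [C], hence in [D], and [alpha 0 = 0]. *)
have lie0 z : h z = 0 -> 0 <= 'd h z (f z).
  move=> hz0; have Cz : C z by rewrite hC /= hz0.
  have [_] := hL z (hCD z Cz).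
  by rewrite hz0 alpha0 oppr0.
rewrite hC /= leNgt; apply/negP => ht.
have cxt : {within `[t0, t], continuous x}.
  apply: continuous_subspaceW cx => s /=; rewrite in_itv/= => /andP[-> st].
  by split=> //; apply: le_lt_trans ttau; rewrite lee_fin.
have h0 : 0 <= (h \o x) t0 by rewrite /= xt0; move: Cx0; rewrite hC.
have [c /andP[t0c ct] [hc hneg]] :=
  last_zero _ _ _ _ t0t (within_continuous_comp _ _ _ _ _ _ cxt ch) h0 ht.
have cxc : {within `[c, t], continuous x}.
  by apply: continuous_subspaceW cxt; apply: subset_itvr; rewrite bnd_simp.
have dxc s : c < s < t -> is_derive s 1 x (f (x s)).
  move=> /andP[cs st]; apply: dx; first exact: le_lt_trans cs.
  by apply: lt_trans ttau; rewrite lte_fin.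
(* Nonnegativity just after [c] contradicts [hneg]. *)
suff : \forall s \near c^'+, 0 <= h (x s).
  move=> N; have [s [cs st hs]] : exists s, [/\ c < s, s <= t & 0 <= h (x s)].
    apply: (@filter_ex _ (c^'+)); near=> s; split.
    - by [].
    - by near: s; exact: nbhs_right_le.
    - by near: s.
  by have := hneg s; rewrite cs st /= ltNge hs => /(_ isT).
have [|Dp|[v]] := hD (x c); first by rewrite hbC.
- have N := near_right_segment _ _ _ _ _ _ ct cxc Dp.
  near=> s.
  have cs : c < s by [].
  have st : s < t by near: s; exact: nbhs_right_lt.
  have Ds : forall u, c <= u <= s -> D (x u) by near: s.
  have cxs : {within `[c, s], continuous (h \o x)}.
    apply: within_continuous_comp ch.
    by apply: continuous_subspaceW cxc; apply: subset_itvl; rewrite bnd_simp ltW.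
  have dhx u : u \in `]c, s[ -> is_derive u 1 (h \o x) ('d h (x u) (f (x u))).
    rewrite in_itv/= => /andP[cu us]; apply: is_derive_diff_comp => //.
    by apply: dxc; rewrite cu (lt_trans us).
  (* The sign of [h (x s)] is that of the derivative at an intermediate time [e], where
     [h (x e) < 0] gives [alpha (h (x e)) < alpha 0 = 0]. *)
  have [e] := MVT cs dhx cxs.
  rewrite in_itv/= => /andP[ce es]; move: hc => /= ->; rewrite subr0 => ->.
  apply: mulr_ge0; last by rewrite subr_ge0 ltW.
  have ces : c <= e <= s by rewrite !ltW.
  have [dome] := hL (x e) (Ds e ces).
  apply: le_trans; rewrite oppr_ge0 ltW// -alpha0.
  apply: alphaI; rewrite ?inE//; apply: hneg.
  by rewrite ce (le_trans (ltW es)) ?ltW.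
(* If the derivative along [v] is negative, [- v] points into [h > 0]. *)
- rewrite neq_lt => /orP[dv|dv]; last exact: nagumo_regular_point hf hh lie0 ct cxc dxc hc dv.
  apply: (nagumo_regular_point _ _ _ _ (- v) _ _ _ hf hh lie0 ct cxc dxc hc).
  by rewrite linearN oppr_gt0.
Unshelve. all: by end_near. Qed.
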